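(* If $X$ is a tree-like continuum and every indecomposable subcontinuum of $X$ is nowhere dense in $X$, then $X$ has a monotone upper semi-continuous decomposition into a dendrite whose elements are the meager composants of $X$; that is, the collection $\mathcal M_X=\{M_x:x\in X\}$ of meager composants is an upper semi-continuous decomposition of $X$ into connected sets, and the quotient space $\mathcal M_X$ is a dendrite.
   Context: A continuum is a nonempty compact connected metric space; a subcontinuum of $X$ is a subset of $X$ that is a continuum in the subspace topology (one-point sets are allowed as subcontinua). A continuum $X$ is tree-like if for every $\varepsilon>0$ there are a tree $T$ (a finite connected acyclic topological graph) and a continuous map $f:X\to T$ such that $\mathrm{diam}(f^{-1}\{t\})<\varepsilon$ for each $t\in T$. A continuum is decomposable if it is the union of two of its proper subcontinua; otherwise it is indecomposable (in particular one-point continua are indecomposable). For a continuum $X$ and $x\in X$, the meager composant of $x$ in $X$ is $M_x=\bigcup\{L\subset X: L$ is a nowhere dense subcontinuum of $X$ and $x\in L\}$. The decomposition $\mathcal M_X$ is upper semi-continuous if for every closed $A\subset X$ the union $\bigcup\{M_x:x\in A\}$ is closed in $X$; a decomposition is monotone if its elements are connected. A dendrite is a locally connected continuum (possibly a single point) which contains no simple closed curve. *)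

(* Defs.v *)
From HB Require Import structures.
From mathcomp Require Import all_boot all_order all_algebra.
From mathcomp Require Import generic_quotient.
From mathcomp Require Import all_classical all_reals topology normedtype.
From mathcomp Require Import ereal.

Set Implicit Arguments.
Unset Strict Implicit.
Unset Printing Implicit Defensive.

Import Order.TTheory GRing.Theory Num.Theory.
Import numFieldTopology.Exports.

Local Open Scope classical_set_scope.
Local Open Scope ring_scope.

(* Subsets used as spaces below are implicitly coerced to their [set_type],
   which carries the subspace topology. *)
Definition homeomorphic (T U : topologicalType) : Prop :=
  exists f : T -> U, exists g : U -> T,
    [/\ cancel f g, cancel g f, continuous f & continuous g].

Definition metrizable (R : realType) (T : topologicalType) : Prop :=
  exists M : metricType R, homeomorphic T M.

(* For [K] a subset of a metrizable space, this says that [K] with the subspace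
   topology is a continuum. *)
Definition continuum (T : topologicalType) (K : set T) : Prop :=
  [/\ K !=set0, compact K & connected K].

Definition decomposable (T : topologicalType) (K : set T) : Prop :=
  exists A B : set T,
    [/\ continuum A, continuum B, A `<` K, B `<` K & K = A `|` B].

Definition indecomposable_continuum (T : topologicalType) (K : set T) : Prop :=
  continuum K /\ ~ decomposable K.

Definition nowhere_dense (T : topologicalType) (A : set T) : Prop :=
  (closure A)° = set0.

Definition locally_connected (T : topologicalType) : Prop :=
  forall (x : T) (U : set T), nbhs x U ->
    exists V : set T, [/\ open_nbhs x V, connected V & V `<=` U].

Definition unit_circle (R : realType) : set (R * R) :=
  [set p | p.1 ^+ 2 + p.2 ^+ 2 = 1].
Arguments unit_circle R : clear implicits.

Definition simple_closed_curve (R : realType) (T : topologicalType)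
    (C : set T) : Prop :=
  homeomorphic C (unit_circle R).

Definition dendrite (R : realType) (T : topologicalType) : Prop :=
  [/\ metrizable R T, continuum [set: T], locally_connected T
    & forall C : set T, ~ simple_closed_curve R C].

(* A simple graph on the vertices [0, ..., n-1].  Symmetry makes [u; v] a
   [cycle] of [e] for every edge uv, so only cycles of length at least 3 are
   excluded. *)
Definition tree_graph (n : nat) (e : rel 'I_n) : Prop :=
  [/\ (0 < n)%N, symmetric e, irreflexive e,
      forall u v : 'I_n, connect e u v
    & forall c : seq 'I_n, ucycle e c -> (size c <= 2)%N].

(* The vertices sit at the standard basis vectors and each edge is the segment
   between its endpoints; [u = v] is allowed in order to include isolated
   vertices. *)
Definition graph_realization (R : realType) (n : nat) (e : rel 'I_n) :
    set 'rV[R]_n :=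
  [set p | exists u v : 'I_n, (u == v) || e u v /\
     exists2 t : R, 0 <= t <= 1 &
       p = (1 - t) *: delta_mx 0 u + t *: delta_mx 0 v].
Arguments graph_realization R {n} e.

Definition topological_tree (R : realType) (T : topologicalType) : Prop :=
  exists (n : nat) (e : rel 'I_n),
    tree_graph e /\ homeomorphic T (graph_realization R e).

(* The diameter of the empty set is -oo here, so empty fibers satisfy
   any bound. *)
Definition diam (R : realType) (X : metricType R) (A : set X) : \bar R :=
  ereal_sup [set (mdist p.1 p.2)%:E | p in A `*` A].

Definition tree_like (R : realType) (X : metricType R) : Prop :=
  forall eps : R, 0 < eps ->
    exists T : topologicalType, topological_tree R T /\
      exists2 f : X -> T, continuous f &
        forall t : T, (diam (f @^-1` [set t]) < eps%:E)%E.

Definition meager_composant (T : topologicalType) (x : T) : set T :=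
  \bigcup_(L in [set L : set T | [/\ continuum L, nowhere_dense L & L x]]) L.

Definition meager_composants (T : topologicalType) : set (set T) :=
  range (@meager_composant T).
Arguments meager_composants T : clear implicits.

Definition upper_semicontinuous (T : topologicalType) (M : T -> set T) : Prop :=
  forall A : set T, closed A -> closed (\bigcup_(x in A) M x).

(* The space of meager composants: the quotient of [T] identifying [x] and [y]
   when [meager_composant x = meager_composant y].  This is an equivalence
   relation whether or not the meager composants partition [T]; when they do,
   its classes are exactly the meager composants. *)
Definition same_meager_composant (T : topologicalType) (x y : T) : bool :=
  `[< meager_composant x = meager_composant y >].

Lemma same_meager_composant_refl (T : topologicalType) :
  reflexive (@same_meager_composant T).
Proof. by move=> x; apply/asboolP. Qed.

Lemma same_meager_composant_sym (T : topologicalType) :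
  symmetric (@same_meager_composant T).
Proof. by move=> x y; apply/asboolP/asboolP => ->. Qed.

Lemma same_meager_composant_trans (T : topologicalType) :
  transitive (@same_meager_composant T).
Proof.
by move=> y x z /asboolP xy /asboolP yz; apply/asboolP; rewrite xy yz.
Qed.

Definition meager_composant_equiv (T : topologicalType) : equiv_rel T :=
  EquivRel (@same_meager_composant T) (@same_meager_composant_refl T)
    (@same_meager_composant_sym T) (@same_meager_composant_trans T).

Definition meager_composant_space (T : topologicalType) : topologicalType :=
  quotient_topology {eq_quot (meager_composant_equiv T)}%qT.

(* Main.v *)
(* A tree-like continuum is hereditarily unicoherent: a map to a tree with
   small enough fibers turns a separation of the intersection of two subcontinua
   into a separation of the intersection of two connected subsets of a tree.
   Hence any points x and y lie in a least subcontinuum I(x, y), and x, y are in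
   the same meager composant iff I(x, y) is nowhere dense.

   Suppose that I(x, y) contains a nonempty open set V.  The least subcontinuum
   containing V is not nowhere dense, so it is decomposable; this splits I(x, y)
   into two subcontinua neither of which contains V.  Splitting twice gives open
   sets U1, U0, U2 lying in this order between x and y.  The set X \ U1 is
   separated between x and y, and likewise X \ U2, so every continuum that joins
   points close to x and y meets U1 and U2 and therefore contains U0.  This
   yields upper semi-continuity, and it also makes the quotient locally
   connected: infinitely many components of a closed neighborhood cannot
   accumulate at a point, because those that reach the boundary share points.
   A simple closed curve in the quotient is the union of two arcs that share
   two points, and the preimages of these arcs contradict hereditary
   unicoherence. *)
Require Import Defs.
From HB Require Import structures.
From mathcomp Require Import all_boot all_order all_algebra.
From mathcomp Require Import generic_quotient lra.
From mathcomp Require Import all_classical all_reals topology normedtype.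
From mathcomp Require Import ereal realfun.

Set Implicit Arguments.
Unset Strict Implicit.
Unset Printing Implicit Defensive.

Import Order.TTheory GRing.Theory Num.Theory.
Import numFieldNormedType.Exports.

Local Open Scope classical_set_scope.

(** * Continua in compact Hausdorff spaces *)

Section ClosedConnected.
Variable T : topologicalType.
Implicit Types A P Q : set T.

(** On [A] the closed set [P] agrees with the open complement of [Q], so its trace is clopen in [A].
    Most connectedness arguments below go through this form. *)
Lemma connected_sub_closed A P Q : connected A -> closed P -> closed Q ->
  A `<=` P `|` Q -> A `&` P `&` Q = set0 -> A `&` P !=set0 -> A `<=` P.
Proof.
move=> cA clP clQ APQ PQ0 AP; rewrite -setIidPl.
apply: cA => //; last by exists P.
exists (~` Q); first exact: closed_openC.
apply/seteqP; split=> x [Ax].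
  by move=> Px; split => // Qx; rewrite -[False]/(set0 x) -PQ0.
by case: (APQ _ Ax).
Qed.

Lemma closed_connectedP A : closed A -> (connected A <->
  forall P Q, closed P -> closed Q -> A = P `|` Q -> P `&` Q = set0 ->
  P !=set0 -> A `<=` P).
Proof.
move=> clA; split=> [cA P Q clP clQ APQ PQ0 P0|H].
  apply: (connected_sub_closed cA clP clQ) => //; first by rewrite APQ.
    by rewrite -setIA PQ0 setI0.
  by case: P0 => x Px; exists x; split => //; rewrite APQ; left.
move=> B B0 [C oC BC] [D cD BD].
apply/seteqP; split; first by rewrite BC => x [].
apply: (H B (A `&` ~` C)) => //.
- by rewrite BD; exact: closedI.
- by apply: closedI => //; exact: open_closedC.
- by rewrite BC -setIUr setUv setIT.
- by rewrite BC -subset0 => x [[_ ?] []].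
Qed.

(** The interior of the union minus [A] is open and lies in [P], hence is empty; so that interior
    lies in [A] and is empty too. *)
Lemma nowhere_dense_closedU A P : closed A -> closed P ->
  nowhere_dense A -> nowhere_dense P -> nowhere_dense (A `|` P).
Proof.
rewrite /nowhere_dense => clA clP.
rewrite -!(iffLR (closure_id _))//; last exact: closedU.
move=> A0 P0; rewrite -subset0 => x xAP.
have oW : open ((A `|` P)° `\` A).
  by apply: openI; [exact: open_interior|exact: closed_openC].
have W0 : (A `|` P)° `\` A = set0.
  rewrite -subset0 -P0 -(iffLR (interior_id _) oW); apply: interiorS.
  by move=> y [/interior_subset []].
have : (A `|` P)° `<=` A by rewrite -setD_eq0.
move/interiorS; rewrite A0 (iffLR (interior_id _)); first exact.
exact: open_interior.
Qed.

End ClosedConnected.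

Section Continua.
Variable T : topologicalType.
Hypothesis hT : hausdorff_space T.
Implicit Types A B C F I K P Q U V Z : set T.

Lemma continuum_closed K : continuum K -> closed K.
Proof. by case=> _ cK _; exact: compact_closed. Qed.

Lemma continuum1 (x : T) : continuum [set x].
Proof.
by split; [exists x|exact: compact_set1|exact: connected1].
Qed.

Lemma continuumU A B : continuum A -> continuum B -> A `&` B !=set0 ->
  continuum (A `|` B).
Proof.
move=> [[x Ax] cA nA] [_ cB nB] AB; split; first by exists x; left.
  exact: compactU.
exact: connectedU.
Qed.

(** If no member lies in [O], the traces of the members on the complement of [O] form a filter base,
    and a cluster point in [K] lies in every member but not in [O]. *)
Lemma directed_bigcap_open (F : set (set T)) K O :
  F K -> compact K -> (forall A, F A -> closed A) ->
  (forall A B, F A -> F B -> exists2 C, F C & C `<=` A `&` B) ->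
  open O -> \bigcap_(A in F) A `<=` O -> exists2 A, F A & A `<=` O.
Proof.
move=> FK cK clF dF oO FO; apply: contrapT => nex.
have PG : ProperFilter (filter_from F (fun A => A `&` ~` O)).
  apply: filter_from_proper; first apply: filter_from_filter.
  - by exists K.
  - move=> A B FA FB; have [C FC CAB] := dF _ _ FA FB.
    by exists C => // x [/CAB[? ?] ?].
  move=> A FA; apply: contrapT => A0; apply: nex; exists A => // x Ax.
  by apply: contrapT => Ox; apply: A0; exists x.
have [|x [Kx clx]] := cK _ PG; first by exists K => // x [].
have xA A : F A -> (A `&` ~` O) x.
  move=> FA; have clAO : closed (A `&` ~` O).
    by apply: closedI; [exact: clF|exact: open_closedC].
  by apply: clAO => U Ux; apply: clx => //; exists A.
have [_] := xA _ FK; apply; apply: FO => A FA.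
by have [] := xA _ FA.
Qed.

Hypothesis cT : compact [set: T].

Lemma compact_closed_sub A : closed A -> compact A.
Proof. by move=> clA; exact: (subclosed_compact clA cT). Qed.

Lemma closed_disjoint_opens P Q : closed P -> closed Q -> P `&` Q = set0 ->
  exists U V, [/\ open U, open V, P `<=` U, Q `<=` V & U `&` V = set0].
Proof.
move=> clP clQ PQ0.
have [|W PW WQ] := compact_normal hT cT clP (t := ~` Q).
  apply/set_nbhsP; exists (~` Q); split => //; first exact: closed_openC.
  exact/disjoints_subset.
have [O [oO PO OW]] := iffLR (set_nbhsP _ _) PW.
exists O, (~` closure W); split => //.
- exact/closed_openC/closed_closure.
- by move=> x Qx /WQ.
- by apply/disjoints_subset => x /OW /subset_closure Wx; exact.
Qed.

(* [U] and [V] stand for neighborhoods of the two pieces of a separation of the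
   intersection; by compactness some member [A] lies in their union. *)
Lemma directed_bigcap_connected (F : set (set T)) : F !=set0 ->
  (forall A, F A -> closed A) ->
  (forall A B, F A -> F B -> exists2 C, F C & C `<=` A `&` B) ->
  (forall A U V, F A -> open U -> open V -> U `&` V = set0 ->
     A `<=` U `|` V -> \bigcap_(A in F) A `&` U !=set0 ->
     \bigcap_(A in F) A `<=` U) ->
  connected (\bigcap_(A in F) A).
Proof.
move=> [K FK] clF dF sepF.
have clI : closed (\bigcap_(A in F) A) by exact: closed_bigI.
apply/(closed_connectedP clI) => P Q clP clQ IPQ PQ0 [p Pp].
have [U [V [oU oV PU QV UV0]]] := closed_disjoint_opens clP clQ PQ0.
have [A FA AUV] : exists2 A, F A & A `<=` U `|` V.
  apply: (directed_bigcap_open FK (compact_closed_sub (clF _ FK)) clF dF).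
  - exact: openU.
  - by rewrite IPQ; apply: setUSS.
have IU : \bigcap_(A in F) A `<=` U.
  by apply: (sepF A U V) => //; exists p; split; [rewrite IPQ; left|exact: PU].
move=> x Ix; have Ux := IU _ Ix; move: Ix; rewrite IPQ => -[//|/QV Vx].
by exfalso; rewrite -[False]/(set0 x) -UV0.
Qed.

(* The intersection of the clopen subsets of [Z] containing [x] is connected:
   this is the equality of components and quasi-components. *)
Lemma cut_wire Z F x : closed Z -> closed F -> Z x ->
  (exists K, [/\ continuum K, K `<=` Z, K x & K `&` F !=set0]) \/
  (exists P Q, [/\ closed P, closed Q, Z = P `|` Q, P `&` Q = set0 &
     P x /\ P `&` F = set0]).
Proof.
move=> clZ clF Zx.
pose G := [set P | [/\ closed P, P `<=` Z, closed (Z `\` P) & P x]].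
have GZ : G Z by split => //; rewrite setDv; exact: closed0.
have clG A : G A -> closed A by case.
have dG A B : G A -> G B -> exists2 C, G C & C `<=` A `&` B.
  move=> [clA AZ clZA Ax] [clB BZ clZB Bx]; exists (A `&` B) => //; split => //.
  - exact: closedI.
  - by move=> y [/AZ].
  - by rewrite setDIr; exact: closedU.
have GT : G !=set0 by exists Z.
have Ix : (\bigcap_(A in G) A) x by move=> A [].
have cI : connected (\bigcap_(A in G) A).
  apply: directed_bigcap_connected => // A U V [clA AZ clZA Ax] oU oV UV0 AUV.
  have UV y : U y -> V y -> False.
    by move=> Uy Vy; rewrite -[False]/(set0 y) -UV0.
  have AUE : A `&` U = A `\` V.
    apply/seteqP; split => y [Ay]; first by move=> Uy; split => // /UV; exact.
    by case: (AUV _ Ay).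
  have AVE : A `&` V = A `\` U.
    apply/seteqP; split => y [Ay]; first by move=> Vy; split => // /UV; exact.
    by case: (AUV _ Ay).
  have clAU : closed (A `&` U).
    by rewrite AUE; apply: closedI => //; exact: open_closedC.
  have clAV : closed (A `&` V).
    by rewrite AVE; apply: closedI => //; exact: open_closedC.
  have dAU : Z `\` (A `&` U) = (Z `\` A) `|` (A `&` V).
    rewrite AVE; apply/seteqP; split => y.
      move=> [Zy nAU]; have [Ay|nAy] := pselect (A y); last by left.
      by right; split => // Uy; apply: nAU.
    by move=> [[Zy nAy]|[/[dup] Ay /AZ Zy nUy]]; split => // -[].
  have dAV : Z `\` (A `&` V) = (Z `\` A) `|` (A `&` U).
    rewrite AUE; apply/seteqP; split => y.
      move=> [Zy nAV]; have [Ay|nAy] := pselect (A y); last by left.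
      by right; split => // Vy; apply: nAV.
    by move=> [[Zy nAy]|[/[dup] Ay /AZ Zy nUy]]; split => // -[].
  (* The piece of [A] that contains [x] belongs to [G]. If it is the one in [U], the intersection
     lies in [U]; the one in [V] is excluded by [y]. *)
  move=> [y [Iy Uy]]; case: (AUV _ Ax) => [Ux|Vx].
    move=> z Iz; suff /Iz[] : G (A `&` U) by [].
    split => //; first by move=> ? [/AZ].
    by rewrite dAU; exact: closedU.
  suff /Iy[_ /(UV _ Uy)] : G (A `&` V) by [].
  split => //; first by move=> ? [/AZ].
  by rewrite dAV; exact: closedU.
have [IF|IF] := pselect (\bigcap_(A in G) A `&` F !=set0).
  left; exists (\bigcap_(A in G) A); split => //.
    split => //; first by exists x.
    by apply: compact_closed_sub; exact: closed_bigI.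
  by move=> y; exact.
right.
have [|P [clP PZ clZP Px] PF] := directed_bigcap_open GZ
    (compact_closed_sub clZ) clG dG (closed_openC clF).
  by move=> y Iy Fy; apply: IF; exists y.
exists P, (Z `\` P); split => //.
- by rewrite setUDr ?setDv ?setD0 //; apply/esym/setUidr.
- by rewrite setDE setICA setICr setI0.
- by split => //; apply/disjoints_subset.
Qed.

Definition hereditarily_unicoherent :=
  forall A B, continuum A -> continuum B -> connected (A `&` B).

Hypothesis huT : hereditarily_unicoherent.

(** For a pair of points this is the least subcontinuum I(x, y). *)
Definition hull A := \bigcap_(K in [set K | continuum K /\ A `<=` K]) K.

Lemma sub_hull A : A `<=` hull A.
Proof. by move=> x Ax K [_]; exact. Qed.

Lemma hull_sub A K : continuum K -> A `<=` K -> hull A `<=` K.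
Proof. by move=> cK AK x; exact. Qed.

(** By unicoherence the continua containing [A] are closed under binary intersection, so their
    intersection is a directed one. A member covered by disjoint open sets lies in the one it meets
    at a point of the hull. *)
Lemma continuum_hull A : connected [set: T] -> A !=set0 -> continuum (hull A).
Proof.
move=> nT [a Aa].
have clF B : continuum B /\ A `<=` B -> closed B by case=> /continuum_closed.
have cTT : continuum [set: T] by split => //; exists a.
split; first by exists a; exact: sub_hull.
  by apply: compact_closed_sub; exact: closed_bigI.
apply: directed_bigcap_connected => //.
- by exists setT.
- move=> B C [cB AB] [cC AC]; exists (B `&` C) => //; split.
    split; [by exists a; split; [exact: AB|exact: AC]| |exact: huT].
    by apply: compact_closed_sub; apply: closedI; exact: continuum_closed.
  by move=> x Ax; split; [exact: AB|exact: AC].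
move=> B U V [cB AB] oU oV UV0 BUV [x [Ix Ux]].
have Bx : B x by exact: Ix.
suff BU : B `<=` U by move=> y /(_ B) By; apply/BU/By.
have [_ _ nB] := cB.
have BUC : B `&` U = B `&` ~` V.
  apply/seteqP; split => y [By].
    by move=> Uy; split => // Vy; rewrite -[False]/(set0 y) -UV0.
  by case: (BUV _ By).
rewrite -setIidPl; apply: nB; first by exists x.
- by exists U.
- by exists (~` V) => //; exact: open_closedC.
Qed.

End Continua.

(** * Meager composants *)

Section MeagerComposants.
Variable T : topologicalType.
Hypotheses (hT : hausdorff_space T) (cT : compact [set: T]).
Hypotheses (nT : connected [set: T]) (huT : hereditarily_unicoherent T).
Hypothesis indecT :
  forall K : set T, indecomposable_continuum K -> nowhere_dense K.
Implicit Types (A B C I K P Q U V : set T) (x y z : T).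

(** A singleton has no nonempty proper subset, so it is indecomposable and [indecT] applies. In
    particular there are no isolated points. *)
Lemma nowhere_dense1 x : nowhere_dense [set x].
Proof.
apply: indecT; split; first exact: continuum1.
move=> [A [B [[[a Aa] _ _] _ [Ax nAx] _ _]]].
by apply: nAx => _ ->; rewrite -(Ax _ Aa).
Qed.

Lemma nowhere_dense_openD U K : closed K -> nowhere_dense K -> open U ->
  U !=set0 -> U `\` K !=set0.
Proof.
move=> clK; rewrite /nowhere_dense -(iffLR (closure_id _))// => K0 oU [x Ux].
apply: contrapT => UK; rewrite -[False]/(set0 x) -K0.
apply: filterS (open_nbhs_nbhs (conj oU Ux)) => y Uy.
by apply: contrapT => Ky; apply: UK; exists y.
Qed.

Let clC K : continuum K -> closed K := @continuum_closed _ hT K.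

Let hullxy x y : continuum (hull [set x; y]).
Proof. by apply: continuum_hull => //; exists x; left. Qed.

Let hull_l x y : hull [set x; y] x.
Proof. by apply: sub_hull; left. Qed.

Let hull_r x y : hull [set x; y] y.
Proof. by apply: sub_hull; right. Qed.

Let hullxy_sub x y K : continuum K -> K x -> K y -> hull [set x; y] `<=` K.
Proof. by move=> cK Kx Ky; apply: hull_sub => // z [->|->]. Qed.

(** Otherwise [I] minus [V] splits into closed sets [P] containing [x] and [Q], with [P] missing
    [H]. Since [V] lies in [H], the sets [P] and [Q] with [H] added would then separate [I]. *)
Lemma continuum_to_set I H V x : continuum I -> I x -> continuum H ->
  H `<=` I -> open V -> V `<=` H -> ~ V x ->
  exists D, [/\ continuum D, D x, D `&` H !=set0 & D `&` V = set0].
Proof.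
move=> cI Ix cH HI oV VH nVx; have [_ _ nI] := cI.
have clIV : closed (I `\` V).
  by apply: closedI; [exact: clC|exact: open_closedC].
have [[D [cD DIV Dx DH]]|[P [Q [clP clQ IVPQ PQ0 [Px PH0]]]]] :=
    cut_wire hT cT clIV (clC cH) (conj Ix nVx).
  by exists D; split => //; apply/disjoints_subset => z /DIV[].
have [[h Hh] _ _] := cH; exfalso.
suff IP : I `<=` P by rewrite -[False]/(set0 h) -PH0; split => //; exact/IP/HI.
apply: (connected_sub_closed (Q := Q `|` H) nI clP).
- by apply: closedU => //; exact: clC.
- move=> z Iz; have [Vz|nVz] := pselect (V z); first by right; right; exact: VH.
  have : (I `\` V) z by [].
  by rewrite IVPQ => -[]; [left|right; left].
- by rewrite -setIA setIUr PQ0 PH0 setU0 setI0.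
- by exists x.
Qed.

(** The hull of an open set inside I(x, y) is not nowhere dense, hence decomposes into two continua.
    Attaching to one a continuum from [x] and to the other a continuum from [y], both off that open
    set, gives [A] and [B]. *)
Lemma hull_split x y V : open V -> V !=set0 -> V `<=` hull [set x; y] ->
  exists A B, [/\ continuum A /\ A x, continuum B /\ B y,
    V `<=` A `|` B, V `\` A !=set0 & V `\` B !=set0].
Proof.
move=> oV V0 VI; set I := hull [set x; y] in VI.
(* The endpoints are removed so that [continuum_to_set] applies at both; [W] stays nonempty because
   points are nowhere dense. *)
pose W := V `\` [set x] `\` [set y].
have cl1 z : closed [set z].
  exact/accessible_closed_set1/hausdorff_accessible.
have oV1 : open (V `\` [set x]) by apply: openI => //; exact: closed_openC.
have W0 : W !=set0.
  apply: (nowhere_dense_openD (cl1 y) (nowhere_dense1 y)) => //.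
  exact: (nowhere_dense_openD (cl1 x) (nowhere_dense1 x)).
have oW : open W.
  by apply: openI => //; exact: closed_openC.
have WV : W `<=` V by move=> z [[]].
have nWx : ~ W x by move=> [[_ +] _]; exact.
have nWy : ~ W y by move=> [_ +]; exact.
have cI : continuum I by exact: hullxy.
have WI : W `<=` I by apply: subset_trans WV VI.
have cH : continuum (hull W) by exact: continuum_hull.
have HI : hull W `<=` I by exact: hull_sub.
have WH : W `<=` hull W by exact: sub_hull.
have [J1 [J2 [cJ1 cJ2 [J1H nJ1] [J2H nJ2] HJ]]] : decomposable (hull W).
  apply: contrapT => nd; have := indecT (conj cH nd).
  by move=> /(nowhere_dense_openD (clC cH))/(_ oW W0)[w [/WH]].
have WJ1 : ~ W `<=` J1 by move=> WJ; apply: nJ1; exact: hull_sub.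
have WJ2 : ~ W `<=` J2 by move=> WJ; apply: nJ2; exact: hull_sub.
have [D [cD Dx DH DW]] := continuum_to_set cI (@hull_l x y) cH HI oW WH nWx.
have [E [cE Ey EH EW]] := continuum_to_set cI (@hull_r x y) cH HI oW WH nWy.
have main K L : continuum K -> continuum L -> hull W = K `|` L ->
    ~ W `<=` K -> ~ W `<=` L -> D `&` K !=set0 ->
    exists A B, [/\ continuum A /\ A x, continuum B /\ B y,
      V `<=` A `|` B, V `\` A !=set0 & V `\` B !=set0].
  move=> cK cL HKL nWK nWL DK.
  have cDK : continuum (D `|` K) by exact: continuumU.
  (* Otherwise [E] meets [K], and the union of [D], [K] and [E] is a continuum from [x] to [y]. It
     contains [W], which [D] and [E] miss, so [K] would contain [W]. *)
  have EL : E `&` L !=set0.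
    apply: contrapT => nEL; have EK : (D `|` K) `&` E !=set0.
      case: EH => z [Ez]; rewrite HKL => -[Kz|Lz].
        by exists z; split; [right|].
      by exfalso; apply: nEL; exists z.
    apply: nWK => w Ww.
    have [[Dw|//]|Ew] : (D `|` K `|` E) w.
    - apply: (hullxy_sub (x := x) (y := y)); last exact: WI.
      + exact: continuumU.
      + by left; left.
      + by right.
    - by exfalso; rewrite -[False]/(set0 w) -DW.
    - by exfalso; rewrite -[False]/(set0 w) -EW.
  have cLE : continuum (L `|` E) by apply: continuumU => //; rewrite setIC.
  exists (D `|` K), (L `|` E); split.
  - by split => //; left.
  - by split => //; right.
  - move=> z /VI; apply: hullxy_sub; [|by left; left|by right; right].
    have -> : D `|` K `|` (L `|` E) = (D `|` hull W) `|` E.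
      by rewrite HKL !setUA.
    apply: continuumU => //; first exact: continuumU.
    by case: EH => h [Eh Hh]; exists h; split => //; right.
  - move/existsNP : nWK => [w /not_implyP[Ww nKw]]; exists w.
    split; [exact: WV|case=> // Dw].
    by rewrite -[False]/(set0 w) -DW.
  - move/existsNP : nWL => [w /not_implyP[Ww nLw]]; exists w.
    split; [exact: WV|case=> // Ew].
    by rewrite -[False]/(set0 w) -EW.
case: (DH) => z [Dz]; rewrite HJ => -[J1z|J2z].
  by apply: (main J1 J2) => //; exists z.
by apply: (main J2 J1) => //; [rewrite setUC|exists z].
Qed.

(** A continuum from [x] to [y] contains the hull and so meets [U]. Hence the complement of [U] is
    separated between [x] and [y] when [x] is outside [U], and a continuum off [U] cannot pass from
    one side to the other. *)
Lemma near_continuum_meets x y U : open U -> U !=set0 ->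
  U `<=` hull [set x; y] ->
  \forall x' \near x & y' \near y,
    forall K, continuum K -> K x' -> K y' -> K `&` U !=set0.
Proof.
move=> oU [u Uu] UI.
have [Ux|nUx] := pselect (U x).
  exists (U, setT) => [|[x' y'] [/= Ux' _] K cK Kx' _]; last by exists x'.
  by split; [exact: open_nbhs_nbhs|exact: filterT].
have [_ _ nI] := hullxy x y.
have [[K [cK KU Kx [z [Kz /= zy]]]]|] :=
    cut_wire hT cT (open_closedC oU) (clC (continuum1 y)) nUx.
  by rewrite zy in Kz; have /KU := hullxy_sub cK Kx Kz (UI _ Uu).
move=> [P [Q [clP clQ UPQ PQ0 [Px Py]]]].
exists (~` Q, ~` P) => /= [|[x' y'] [/= nQx nPy] K [_ _ nK] Kx Ky].
  split; apply: open_nbhs_nbhs; split; try exact: closed_openC.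
    by move=> Qx; rewrite -[False]/(set0 x) -PQ0.
  by move=> Py'; rewrite -[False]/(set0 y) -Py.
apply: contrapT => KU0.
have KPQ : K `<=` P `|` Q.
  by rewrite -UPQ => z Kz Uz; apply: KU0; exists z.
suff /(_ _ Ky) : K `<=` P by [].
apply: (connected_sub_closed nK clP clQ KPQ).
  by rewrite -setIA PQ0 setI0.
by exists x'; split => //; case: (KPQ _ Kx).
Qed.

Lemma meager_composantPn x y : ~ meager_composant x y ->
  exists2 U, open U /\ U !=set0 & U `<=` hull [set x; y].
Proof.
move=> nxy; exists (hull [set x; y])°; last exact: interior_subset.
split; first exact: open_interior.
apply: contrapT => I0; apply: nxy; exists (hull [set x; y]) => //; split => //.
rewrite /nowhere_dense -(iffLR (closure_id _)); last exact: clC.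
by rewrite -subset0 => z Iz; apply: I0; exists z.
Qed.

(* Any continuum [K] close to both [x] and [y] meets [V1 `\` B1] and
   [V `\` A], so that [K `|` A1 `|` B] is a continuum joining [x] to [y]; hence
   [K] contains the part [U] of the hull that [A1] and [B] miss. *)
Lemma near_continuum_contains x y : ~ meager_composant x y ->
  exists2 U, open U /\ U !=set0 &
    \forall x' \near x & y' \near y,
      forall K, continuum K -> K x' -> K y' -> U `<=` K.
Proof.
move=> /meager_composantPn[V [oV V0] VI].
have [A [B [[cA Ax] [cB By] VAB VA VB]]] := hull_split oV V0 VI.
have oVD K W : open W -> continuum K -> open (W `\` K).
  by move=> oW cK; apply: openI => //; apply: closed_openC; exact: clC.
(* The sets [V1] minus [B1], [V1] minus [A1] and [V] minus [A] are the U1, U0 and U2 of the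
   overview, in order from [x] to [y]. Splitting [V1] rather than [V] keeps the middle set off
   [B]. *)
pose V1 := V `\` B.
have V1I : V1 `<=` hull [set x; y] by move=> z [/VI].
have oV1 : open V1 by exact: oVD.
have [A1 [B1 [[cA1 A1x] [cB1 B1y] V1AB V1A V1B]]] := hull_split oV1 VB V1I.
exists (V1 `\` A1); first by split => //; exact: oVD.
have UI1 : V1 `\` B1 `<=` hull [set x; y] by move=> z [/V1I].
have UI2 : V `\` A `<=` hull [set x; y] by move=> z [/VI].
have := near_continuum_meets (oVD _ _ oV1 cB1) V1B UI1.
have := near_continuum_meets (oVD _ _ oV cA) VA UI2.
apply: filterS2 => -[x' y'] /= N2 N1 K cK Kx Ky u [V1u nA1u].
have [z [Kz [V1z nB1z]]] := N1 K cK Kx Ky.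
have A1z : A1 z by case: (V1AB _ V1z).
have [t [Kt [Vt nAt]]] := N2 K cK Kx Ky.
have Bt : B t by case: (VAB _ Vt).
have : (A1 `|` K `|` B) u.
  apply: (hullxy_sub (x := x) (y := y)) => //; last exact: V1I.
  - apply: continuumU => //; first by apply: continuumU => //; exists z.
    by exists t; split => //; right.
  - by left; left.
  - by right.
by case: V1u => _ nBu [[|]|].
Qed.

Lemma meager_composant_refl x : meager_composant x x.
Proof.
by exists [set x] => //; split => //; [exact: continuum1|exact: nowhere_dense1].
Qed.

Lemma meager_composant_sym x y : meager_composant x y -> meager_composant y x.
Proof. by move=> [L [cL nL Lx] Ly]; exists L. Qed.

Lemma meager_composant_trans y x z : meager_composant x y ->
  meager_composant y z -> meager_composant x z.
Proof.
move=> [L [cL nL Lx] Ly] [M [cM nM My] Mz]; exists (L `|` M); last by right.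
split; [by apply: continuumU => //; exists y| |by left].
by apply: nowhere_dense_closedU => //; exact: clC.
Qed.

Lemma meager_composant_eqP x y :
  meager_composant x = meager_composant y <-> meager_composant x y.
Proof.
split=> [->|xy]; first exact: meager_composant_refl.
apply/seteqP; split=> z; apply: meager_composant_trans => //.
exact: meager_composant_sym.
Qed.

Lemma connected_meager_composant x : connected (meager_composant x).
Proof.
by apply: bigcup_connected; [exists x => L []|move=> L [[]]].
Qed.

Lemma partition_meager_composants :
  partition (meager_composants T) id [set: T].
Proof.
split.
- apply/seteqP; split => // x _; exists (meager_composant x); first by exists x.
  exact: meager_composant_refl.
- move=> _ _ [x _ <-] [y _ <-] [z [/= xz yz]].
  by apply/meager_composant_eqP/(meager_composant_trans xz)/meager_composant_sym.
- by move=> _ [x _ <-]; exists x; exact: meager_composant_refl.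
Qed.

(** A nowhere dense continuum cannot contain the open set that all continua joining nearby points
    contain. Lying in a common meager composant is thus a closed relation. *)
Lemma near_not_meager_composant x y : ~ meager_composant x y ->
  \forall x' \near x & y' \near y, ~ meager_composant x' y'.
Proof.
move=> /near_continuum_contains[U [oU U0]]; apply: filterS => -[x' y'] /= UK.
move=> [L [cL nL Lx] Ly].
have [z [Uz]] := nowhere_dense_openD (clC cL) nL oU U0; apply.
exact: (UK _ cL Lx Ly).
Qed.

(** For [z] outside the union, compactness of [A] merges the neighborhoods of [z] obtained at the
    points of [A] into one. *)
Lemma meager_composant_usc : upper_semicontinuous (@meager_composant T).
Proof.
move=> A clA; rewrite -[X in closed X]setCK; apply: open_closedC.
rewrite openE => z nz.
have cA : near_covering A by exact/compact_near_coveringP/compact_closed_sub.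
have := cA T (nbhs z) (fun z' x => ~ meager_composant x z').
have H x : A x -> \forall x' \near x & z' \near z, ~ meager_composant x' z'.
  by move=> Ax; apply: near_not_meager_composant => xz; apply: nz; exists x.
by move=> /(_ _ H); apply: filterS => z' nAz' [x Ax]; exact: nAz'.
Qed.

End MeagerComposants.

(** * Monotone quotients *)

Section QuotientMap.
Variables (T Y : topologicalType) (q : T -> Y).
Hypotheses (hT : hausdorff_space T) (cT : compact [set: T]).
Hypothesis q_open : forall U : set Y, open (q @^-1` U) -> open U.
Hypothesis q_continuous : continuous q.
Hypothesis q_surj : forall p, exists x, q x = p.
Hypothesis q_usc : forall A, closed A -> closed (q @^-1` (q @` A)).

Lemma quotient_image_closed A : closed A -> closed (q @` A).
Proof.
move=> /q_usc clA; rewrite -[X in closed X]setCK; apply: open_closedC.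
by apply: q_open; rewrite preimage_setC; exact: closed_openC.
Qed.

(** The set [O] consists of the points whose whole fiber lies in the interior of the preimage of
    [W]. It is open because [q] is a closed map. *)
Lemma nbhs_quotient p (W : set Y) :
  (forall x, q x = p -> nbhs x (q @^-1` W)) -> nbhs p W.
Proof.
move=> HW; pose O := ~` (q @` ~` (q @^-1` W)°).
have oO : open O.
  by apply/closed_openC/quotient_image_closed/open_closedC/open_interior.
apply: filterS (open_nbhs_nbhs (conj oO _)) => [z Oz|].
  have [x qx] := q_surj z; rewrite -qx; apply: contrapT => nWx; apply: Oz.
  by exists x => // /interior_subset.
by move=> [x + qx]; apply; exact: HW.
Qed.

Lemma quotient_compact : compact [set: Y].
Proof.
have -> : [set: Y] = q @` [set: T].
  by apply/seteqP; split => // p _; have [x <-] := q_surj p; exists x.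
by apply: continuous_compact => //; exact: continuous_subspaceT.
Qed.

Lemma quotient_connected : connected [set: T] -> connected [set: Y].
Proof.
have -> : [set: Y] = q @` [set: T].
  by apply/seteqP; split => // p _; have [x <-] := q_surj p; exists x.
move=> nT; apply: connected_continuous_connected => //.
exact: continuous_subspaceT.
Qed.

Let fiberE x : q @^-1` (q @` [set x]) = q @^-1` [set q x].
Proof.
by apply/seteqP; split=> y /=; [move=> [_ -> ->]|move=> ->; exists x].
Qed.

Lemma quotient_hausdorff : hausdorff_space Y.
Proof.
rewrite open_hausdorff => s t st.
have [[x qx] [y qy]] := (q_surj s, q_surj t).
have cl1 (z : T) : closed [set z].
  exact/accessible_closed_set1/hausdorff_accessible.
have cls := q_usc (cl1 x); have clt := q_usc (cl1 y).
rewrite fiberE qx in cls; rewrite fiberE qy in clt.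
have [|U [V [oU oV sU tV UV0]]] := closed_disjoint_opens hT cT cls clt.
  by rewrite -subset0 => z [/= -> /eqP]; rewrite (negPf st).
exists (~` (q @` ~` U), ~` (q @` ~` V)) => /=.
  by split; apply/mem_set; [move=> [z + qz]; apply; exact: sU|
                            move=> [z + qz]; apply; exact: tV].
split; [| |apply/eqP; rewrite -subset0 => p [nU nV]].
- exact/closed_openC/quotient_image_closed/open_closedC.
- exact/closed_openC/quotient_image_closed/open_closedC.
have [z qz] := q_surj p; suff : set0 z by []; rewrite -UV0.
by split; apply: contrapT => nz; [apply: nU|apply: nV]; exists z.
Qed.

(** Connected fibers lie on one side of any separation of the preimage, so the separation descends
    to a separation of [A]. *)
Lemma quotient_preimage_connected A : (forall p, connected (q @^-1` [set p])) ->
  closed A -> connected A -> connected (q @^-1` A).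
Proof.
move=> fibC clA nA.
have clqA : closed (q @^-1` A) by exact: closed_comp.
apply/(closed_connectedP clqA) => P Q clP clQ APQ PQ0 [x Px].
have fibP y z : P y -> q y = q z -> P z.
  move=> Py yz; have Ay : A (q y) by rewrite -[A _]/((q @^-1` A) y) APQ; left.
  suff : q @^-1` [set q y] `<=` P by apply.
  apply: (connected_sub_closed (fibC _) clP clQ).
  - by rewrite -APQ => t /= ->.
  - by rewrite -setIA PQ0 setI0.
  - by exists y.
have AP : A `<=` q @` P.
  apply: (connected_sub_closed nA (quotient_image_closed clP)
            (quotient_image_closed clQ)).
  - move=> p Ap; have [z qz] := q_surj p.
    have : (q @^-1` A) z by rewrite /= qz.
    by rewrite APQ => -[Pz|Qz]; [left|right]; exists z.
  - rewrite -subset0 => p [[_ [y Py qy]] [z Qz qz]].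
    suff : set0 z by []; rewrite -PQ0.
    by split => //; apply: (fibP y) => //; rewrite qy.
  - exists (q x); split; last by exists x.
    by rewrite -[A _]/((q @^-1` A) x) APQ; left.
by move=> z /AP[y Py yz]; exact: (fibP y).
Qed.

Lemma quotient_preimage_continuum A : (forall p, connected (q @^-1` [set p])) ->
  continuum A -> continuum (q @^-1` A).
Proof.
move=> fibC [[a Aa] cA nA].
have clA : closed A by exact: compact_closed quotient_hausdorff cA.
split; [by have [x qx] := q_surj a; exists x; rewrite /= qx| |].
  by apply: compact_closed_sub => //; exact: closed_comp.
exact: quotient_preimage_connected.
Qed.

Hypothesis sepY : forall x y, q x <> q y -> exists u : Y,
  \forall x' \near x & y' \near y,
    forall K, continuum K -> K (q x') -> K (q y') -> K u.

(** Points near [p] are joined inside a closed neighborhood [F] to its boundary [B]. By [sepY],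
    continua from near [p] to near a given point of [B] share a point [u], which prevents components
    of [F] from accumulating at [p]; compactness of [B] makes the neighborhood of [p] uniform. *)
Lemma near_connected_component p (G : set Y) : connected [set: Y] -> open G ->
  G p -> nbhs p (connected_component G p).
Proof.
move=> nY oG Gp; have [hY cY] := (quotient_hausdorff, quotient_compact).
have [GT|nGT] := pselect (G = setT).
  by rewrite GT connected_component_id //; exact: filterT.
have [F [clF FG Fp]] : exists F, [/\ closed F, F `<=` G & nbhs p F].
  have [|C pC CG] := compact_regular hY cY (filterT : nbhs p setT) (t := G).
    exact: open_nbhs_nbhs.
  exists (closure C); split => //; first exact: closed_closure.
  exact: filterS (@subset_closure _ C) pC.
pose B := F `\` F°.
have clB : closed B by apply: closedI => //; exact/open_closedC/open_interior.
(* Boundary bumping: a relatively clopen part of [F] that misses [B] is clopen in [Y], hence equal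
   to [Y], which would force [G] to be everything. *)
have reachB w : F° w ->
    exists K, [/\ continuum K, K `<=` F, K w & K `&` B !=set0].
  move=> Fw; have [//|[P [Q [clP clQ FPQ PQ0 [Pw PB0]]]]] :=
    cut_wire hY cY clF clB (interior_subset Fw).
  exfalso; apply: nGT; apply/seteqP; split => // z _; apply: FG.
  suff -> : F = setT by [].
  rewrite -subTset; apply: (@subset_trans _ P); last by rewrite FPQ; left.
  rewrite -(nY P) //; first by exists w.
    exists (F° `\` Q).
      by apply: openI; [exact: open_interior|exact: closed_openC].
    rewrite setTI; apply/seteqP; split => [t Pt|t [/interior_subset]].
      split; last by move=> Qt; rewrite -[False]/(set0 t) -PQ0.
      apply: contrapT => nFt; rewrite -[False]/(set0 t) -PB0; split => //.
      by split => //; rewrite FPQ; left.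
    by rewrite FPQ => -[].
  by exists P; rewrite ?setTI.
suff : \forall p' \near p, forall b K, B b -> continuum K -> K `<=` F ->
    K p' -> K b -> connected_component F p p'.
  move=> H; near=> p'.
  have [|K [cK KF Kp' [b [Kb Bb]]]] := reachB p'.
    by near: p'; exact: nbhs_interior.
  have [C [Cp CF nC] Cp'] : connected_component F p p'.
    by apply: (near H p' _ b K).
  by exists C => //; split => //; exact: subset_trans FG.
apply: nbhs_quotient => x qx.
have cqB : near_covering (q @^-1` B).
  by apply/compact_near_coveringP/compact_closed_sub => //; exact: closed_comp.
have := cqB T (nbhs x) (fun x' y' => forall K, continuum K -> K `<=` F ->
  K (q x') -> K (q y') -> connected_component F p (q x')).
have H y : (q @^-1` B) y -> \forall y' \near y & x' \near x, forall K,
    continuum K -> K `<=` F -> K (q x') -> K (q y') ->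
    connected_component F p (q x').
  move=> [_ nFy].
  have [|u /= [[N1 N2] /= [N1x N2y] HN]] := sepY (x := x) (y := y).
    by rewrite qx => pqy; apply: nFy; rewrite -pqy; exact: Fp.
  have Ku z K : continuum K -> K `<=` F -> K z -> K u ->
      connected_component F u z.
    by move=> [_ _ nK] KF Kz Ku; exists K.
  (* If [u] is in the component of [p], each [K] through [u] stays in it. If not, the closed
     component of [u] misses [p], and close enough to [x] no such [K] exists. *)
  have [pu|npu] := pselect (connected_component F p u).
    exists (N2, N1) => // -[y' x'] [/= N2y' N1x'] K cK KF Kx' Ky'.
    apply: (connected_component_trans pu); apply: (Ku _ K) => //.
    exact: (HN (x', y')).
  pose N3 := q @^-1` ~` connected_component F u.
  have N3x : nbhs x N3.
    apply: open_nbhs_nbhs; split.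
      apply: open_comp => //; apply: closed_openC; exact: component_closed.
    by rewrite /N3 /= qx => /connected_component_sym.
  exists (N2, N1 `&` N3); first by split => //; exact: filterI.
  move=> -[y' x'] [/= N2y' [N1x' N3x']] K cK KF Kx' Ky'; exfalso; apply: N3x'.
  by apply: (Ku _ K) => //; exact: (HN (x', y')).
move=> /(_ _ H); apply: filterS => x' Hx' b K Bb cK KF Kx' Kb.
have [y qy] := q_surj b; apply: (Hx' y _ K) => //; by rewrite /= qy.
Unshelve. all: by end_near. Qed.

Lemma quotient_locally_connected : connected [set: Y] -> locally_connected Y.
Proof.
move=> nY p U Up; exists (connected_component U° p); split.
- split; last by apply: connected_component_refl; exact: Up.
  rewrite openE => z Uz; rewrite (same_connected_component Uz).
  apply: near_connected_component => //; first exact: open_interior.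
  exact: connected_component_sub Uz.
- exact: component_connected.
- exact: subset_trans (@connected_component_sub _ _ _) (@interior_subset _ _).
Qed.

End QuotientMap.

(** * Simple closed curves as unions of two arcs *)

Section SimpleClosedCurve.
Local Open Scope ring_scope.
Variable R : realType.

(** The values 1 and -1 of [s] give the closed upper and lower halves of the unit circle, as images
    of a segment. *)
Definition half_circle (s : R) : set (R * R) :=
  (fun t => (t, s * Num.sqrt (1 - t ^+ 2))) @` `[-1, 1].

Lemma continuum_half_circle s : continuum (half_circle s).
Proof.
have cy : continuous (fun t : R => s * Num.sqrt (1 - t ^+ 2)).
  move=> t; apply: cvgM; first exact: cvg_cst.
  apply: (@continuous_comp _ _ _ (fun t : R => 1 - t ^+ 2) Num.sqrt).
    by apply: cvgB; [exact: cvg_cst|exact: exprn_continuous].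
  exact: sqrt_continuous.
have cont : continuous (fun t : R => (t, s * Num.sqrt (1 - t ^+ 2))).
  move=> t A [[U V] /= [Ut Vt] UVA].
  by apply: filterS2 Ut (cy t _ Vt) => x Ux Vx; exact: (UVA (x, _)).
split.
- by exists (1, s * Num.sqrt (1 - 1 ^+ 2)), 1 => //=; rewrite in_itv/=; lra.
- apply: continuous_compact; first exact: continuous_subspaceT.
  exact: segment_compact.
- apply: connected_continuous_connected; first exact: segment_connected.
  exact: continuous_subspaceT.
Qed.

Lemma half_circle_sub s : s ^+ 2 = 1 -> half_circle s `<=` unit_circle R.
Proof.
move=> s1 _ [t /= + <-]; rewrite in_itv /= => /andP[t1 t2].
rewrite /unit_circle /= exprMn s1 mul1r sqr_sqrtr ?subrKC //.
by rewrite subr_ge0; nra.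
Qed.

Lemma half_circleI : half_circle 1 `&` half_circle (-1) = [set (-1, 0); (1, 0)].
Proof.
have sqrt0 : Num.sqrt (1 - 1 ^+ 2) = 0 :> R by rewrite expr1n subrr sqrtr0.
apply/seteqP; split => [_ [[t _ <-] [u + [ut]]]|_ /= [->|->]].
- rewrite ut mul1r mulN1r => + /eqP; rewrite /= in_itv /= => /andP[tN1 t1].
  rewrite eq_sym -addr_eq0 -mulr2n mulrn_eq0 /= => s0.
  rewrite (eqP s0); move: s0; rewrite sqrtr_eq0 subr_le0 => t2.
  have /eqP : (t - 1) * (t + 1) = 0 by nra.
  by rewrite mulf_eq0 subr_eq0 addr_eq0 => /orP[]/eqP ->; [right|left].
- split; exists (-1); rewrite /= ?in_itv /= ?sqrrN ?sqrt0 ?mulr0 //; lra.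
- split; exists 1; rewrite /= ?in_itv /= ?sqrt0 ?mulr0 //; lra.
Qed.

Lemma simple_closed_curve_arcs (Y : topologicalType) (C : set Y) :
  simple_closed_curve R C -> exists (A B : set Y) (a b : Y),
  [/\ continuum A, continuum B, a <> b & A `&` B = [set a; b]].
Proof.
move=> [f [g [fK gK cf cg]]].
have p0 : unit_circle R (1, 0) by rewrite /unit_circle /= expr1n expr0n addr0.
pose h := set_val \o g.
(* The parametrization [h] is extended to the whole plane, with the image of (1, 0) as default value
   off the circle. *)
pose G := 'valL_(h (SigSub (mem_set p0))) h.
have ch : continuous h.
  by move=> p; apply: continuous_comp; [exact: cg|exact: initial_continuous].
have cG : {within unit_circle R, continuous G}.
  exact/subspace_valL_continuousP'.
have iG : {in unit_circle R &, injective G}.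
  by apply/valL_injP => p r /val_inj; exact: (can_inj gK).
have [cp cm] : half_circle 1 `<=` unit_circle R /\
    half_circle (-1) `<=` unit_circle R.
  by split; apply: half_circle_sub; rewrite ?sqrrN expr1n.
have cont s : half_circle s `<=` unit_circle R ->
    continuum (G @` half_circle s).
  move=> sub; have [[x hx] ch' nh] := continuum_half_circle s; split.
  - by exists (G x), x.
  - by apply: continuous_compact => //; exact: continuous_subspaceW cG.
  - apply: connected_continuous_connected => //.
    exact: continuous_subspaceW cG.
exists (G @` half_circle 1), (G @` half_circle (-1)), (G (-1, 0)), (G (1, 0)).
have [ml mr] : (half_circle 1 `&` half_circle (-1)) (-1, 0) /\
    (half_circle 1 `&` half_circle (-1)) (1, 0).
  by rewrite half_circleI; split; [left|right].
split; [exact: cont|exact: cont| |].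
  move=> /iG; rewrite !inE => /(_ (cp _ ml.1) (cp _ mr.1)) [] /eqP.
  by rewrite -subr_eq0 -opprD oppr_eq0 -mulr2n pnatr_eq0.
apply/seteqP; split => [p [[x px <-] [y py]]|p].
  move=> /iG; rewrite !inE => /(_ (cm _ py) (cp _ px)) yx; subst y.
  have : [set (-1, 0); (1, 0)] x by rewrite -half_circleI.
  by move=> [] ->; [left|right].
by move=> [] ->; split; eexists; [exact: ml.1|by []|exact: ml.2|by []|
  exact: mr.1|by []|exact: mr.2|by []].
Qed.

End SimpleClosedCurve.

(** * Hereditary unicoherence of tree-like continua *)

Section ConnectedIntersections.
Variable T : topologicalType.
Implicit Types A B P Q Z : set T.

(** This unicoherence property passes to one-point unions, so it can be proved for a tree one edge
    at a time. *)
Definition connected_meets Z := forall A B, closed A -> closed B ->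
  A `<=` Z -> B `<=` Z -> connected A -> connected B -> connected (A `&` B).

Section Wedge.
Variables (Z1 Z2 : set T) (v : T).
Hypotheses (clZ1 : closed Z1) (clZ2 : closed Z2) (Z12 : Z1 `&` Z2 = [set v]).

Lemma wedge_point A : connected A -> A `<=` Z1 `|` Z2 ->
  A `&` Z1 !=set0 -> A `&` Z2 !=set0 -> A v.
Proof.
move=> nA AZ AZ1 [z [Az Z2z]]; apply: contrapT => nAv.
suff AZ1s : A `<=` Z1.
  have : (Z1 `&` Z2) z by split => //; exact: AZ1s.
  by rewrite Z12 => /= zv; apply: nAv; rewrite -zv.
apply: (connected_sub_closed nA clZ1 clZ2 AZ) => //.
by rewrite -setIA Z12 -subset0 => y [Ay /= yv]; apply: nAv; rewrite -yv.
Qed.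

(** If [A] misses [v], it lies on one side. Otherwise a separation of the trace on [Z1] extends to
    [A] by adding the trace on [Z2] to the piece containing [v]. *)
Lemma wedge_connected A : closed A -> connected A -> A `<=` Z1 `|` Z2 ->
  connected (A `&` Z1).
Proof.
move=> clA nA AZ; apply/(closed_connectedP (closedI clA clZ1)).
move=> P Q clP clQ APQ PQ0 [p Pp].
have PAZ : P `<=` A `&` Z1 by rewrite APQ; left.
have QAZ : Q `<=` A `&` Z1 by rewrite APQ; right.
have Z1v : Z1 v by have : [set v] v by []; rewrite -Z12 => -[].
have Z12v z : Z1 z -> Z2 z -> z = v.
  by move=> z1 z2; have : (Z1 `&` Z2) z by []; rewrite Z12.
have clAZ2 : closed (A `&` Z2) by exact: closedI.
have [Av|nAv] := pselect (A v); last first.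
  have AZ1 : A `<=` Z1.
    move=> z Az; have [//|Z2z] := AZ _ Az; exfalso; apply: nAv.
    by apply: wedge_point => //; [exists p; exact: PAZ|exists z].
  apply: subset_trans (@subIsetl _ _ _) _.
  apply: (connected_sub_closed nA clP clQ).
  - by rewrite -APQ => z Az; split => //; exact: AZ1.
  - by rewrite -setIA PQ0 setI0.
  - by exists p; split => //; have [] := PAZ _ Pp.
have [Pv|Qv] : (P `|` Q) v by rewrite -APQ.
  have AP : A `<=` P `|` (A `&` Z2).
    apply: (connected_sub_closed nA (closedU clP clAZ2) clQ).
    - move=> z Az; case: (AZ _ Az) => [Z1z|Z2z]; last by left; right.
      have : (A `&` Z1) z by [].
      by rewrite APQ => -[Pz|Qz]; [left; left|right].
    - rewrite -subset0 => z [[Az [Pz|[_ Z2z]]] Qz]; first by rewrite -PQ0.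
      have [_ Z1z] := QAZ _ Qz.
      by rewrite -PQ0; split => //; rewrite (Z12v z).
    - by exists v; split => //; left.
  by move=> z [/AP[//|[_ Z2z]] Z1z]; rewrite (Z12v z).
apply: subset_trans (@subIsetl _ _ _) _.
apply: (connected_sub_closed nA clP (closedU clQ clAZ2)).
- move=> z Az; case: (AZ _ Az) => [Z1z|Z2z]; last by right; right.
  have : (A `&` Z1) z by [].
  by rewrite APQ => -[Pz|Qz]; [left|right; left].
- rewrite -subset0 => z [[Az Pz] [Qz|[_ Z2z]]]; first by rewrite -PQ0.
  have [_ Z1z] := PAZ _ Pz.
  by rewrite -PQ0; split => //; rewrite (Z12v z).
- by exists p; split => //; have [] := PAZ _ Pp.
Qed.

End Wedge.

(** On each side the trace of the intersection is the intersection of two connected traces. If both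
    traces are nonempty, [A] and [B] both contain [v], where the two traces meet. *)
Lemma connected_meets_wedge Z1 Z2 v : closed Z1 -> closed Z2 ->
  Z1 `&` Z2 = [set v] -> connected_meets Z1 -> connected_meets Z2 ->
  connected_meets (Z1 `|` Z2).
Proof.
move=> cl1 cl2 Z12 m1 m2 A B clA clB AZ BZ nA nB.
have Z21 : Z2 `&` Z1 = [set v] by rewrite setIC.
have AZ' : A `<=` Z2 `|` Z1 by rewrite setUC.
have BZ' : B `<=` Z2 `|` Z1 by rewrite setUC.
have n1 : connected (A `&` B `&` Z1).
  rewrite -(setIid Z1) setIACA; apply: m1; try exact: closedI.
  - exact: subIsetr.
  - exact: subIsetr.
  - exact: (wedge_connected cl1 cl2 Z12).
  - exact: (wedge_connected cl1 cl2 Z12).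
have n2 : connected (A `&` B `&` Z2).
  rewrite -(setIid Z2) setIACA; apply: m2; try exact: closedI.
  - exact: subIsetr.
  - exact: subIsetr.
  - exact: (wedge_connected cl2 cl1 Z21).
  - exact: (wedge_connected cl2 cl1 Z21).
have -> : A `&` B = (A `&` B `&` Z1) `|` (A `&` B `&` Z2).
  by rewrite -setIUr; apply/esym/setIidPl => z [/AZ].
have [-> |/set0P[z [[Az Bz] Z1z]]] := eqVneq (A `&` B `&` Z1) set0.
  by rewrite set0U.
have [-> |/set0P[y [[Ay By] Z2y]]] := eqVneq (A `&` B `&` Z2) set0.
  by rewrite setU0.
apply: connectedU => //; exists v.
have Av : A v by apply: (wedge_point cl1 cl2 Z12) => //; [exists z|exists y].
have Bv : B v by apply: (wedge_point cl1 cl2 Z12) => //; [exists z|exists y].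
by have : [set v] v by []; rewrite -Z12 => -[Z1v Z2v].
Qed.

Lemma connected_meets1 x : connected_meets [set x].
Proof.
move=> A B _ _ Ax Bx nA nB.
have [[z [/[dup] Az /Ax zx] Bz]|AB0] := pselect (A `&` B !=set0).
  suff -> : A `&` B = [set x] by exact: connected1.
  by rewrite -zx; apply/seteqP; split => [y [/Ax -> _]|_ ->].
suff -> : A `&` B = set0 by exact: connected0.
by rewrite -subset0 => y ?; apply: AB0; exists y.
Qed.

End ConnectedIntersections.

(** * Intersections of connected subsets of a tree *)

Section TreeRealization.
Local Open Scope ring_scope.
Variables (R : realType) (n : nat) (e : rel 'I_n).
Implicit Types (u v w : 'I_n) (S : {set 'I_n}) (t : R).

Definition edge_point u v t : 'rV[R]_n :=
  (1 - t) *: delta_mx 0 u + t *: delta_mx 0 v.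

Definition edge_segment u v : set 'rV[R]_n := edge_point u v @` `[0, 1].

Lemma edge_point_coord u v t i :
  edge_point u v t 0 i = (1 - t) * (i == u)%:R + t * (i == v)%:R.
Proof. by rewrite !mxE eqxx. Qed.

Lemma edge_point_continuous u v : continuous (edge_point u v).
Proof.
move=> t; apply: cvgD; apply: cvgZ; try exact: cvg_cst; last exact: cvg_id.
by apply: cvgB; [exact: cvg_cst|exact: cvg_id].
Qed.

Lemma edge_segment_closed u v : closed (edge_segment u v).
Proof.
apply: compact_closed; first exact: norm_hausdorff.
apply: continuous_compact; last exact: segment_compact.
by apply: continuous_subspaceT; exact: edge_point_continuous.
Qed.

Lemma edge_segmentC u v : edge_segment u v = edge_segment v u.
Proof.
suff H a b : edge_segment a b `<=` edge_segment b a by apply/seteqP; split.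
move=> _ [t + <-]; rewrite /= in_itv /= => /andP[t0 t1]; exists (1 - t).
  by rewrite /= in_itv /= subr_ge0 t1 gerBl.
by rewrite /edge_point subKr addrC.
Qed.

(** The coordinate at [v] identifies the edge with an interval, and intersections of intervals are
    intervals. *)
Lemma connected_meets_edge_segment u v :
  u != v -> connected_meets (edge_segment u v).
Proof.
move=> uv A B _ _ As Bs nA nB; pose c (p : 'rV[R]_n) := p 0 v.
have cK p : edge_segment u v p -> edge_point u v (c p) = p.
  move=> [t _ <-]; rewrite /c edge_point_coord eqxx eq_sym (negPf uv).
  by rewrite mulr0 mulr1 add0r.
have cc D : {within D, continuous c}.
  by apply: continuous_subspaceT; exact: coord_continuous.
have itv D : connected D -> is_interval (c @` D).
  move=> nD; apply/connected_intervalP.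
  exact: connected_continuous_connected.
have -> : A `&` B = edge_point u v @` (c @` A `&` c @` B).
  apply/seteqP; split => [p [Ap Bp]|_ [_ [[p Ap <-] [r Br pr]] <-]].
    by exists (c p); [split; exists p|apply/cK/As].
  have rp : r = p by rewrite -(cK _ (Bs _ Br)) pr (cK _ (As _ Ap)).
  by rewrite (cK _ (As _ Ap)); split => //; rewrite -rp.
apply: connected_continuous_connected; last first.
  by apply: continuous_subspaceT; exact: edge_point_continuous.
apply/connected_intervalP => x y [Ax Bx] [Ay By] z xyz.
by split; [exact: (itv _ nA) Ax Ay _ xyz|exact: (itv _ nB) Bx By _ xyz].
Qed.

Definition subgraph_realization S : set 'rV[R]_n :=
  [set p | exists u v, [/\ u \in S, v \in S, (u == v) || e u v &
     edge_segment u v p]].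

Lemma graph_realizationE :
  graph_realization R e = subgraph_realization [set: 'I_n].
Proof.
apply/seteqP; split => p.
  move=> [u [v [uv [t t01 ->]]]]; exists u, v; split; rewrite ?inE //.
  by exists t; rewrite //= in_itv.
by move=> [u [v [_ _ uv [t + <-]]]]; rewrite /= in_itv /= => t01;
  exists u, v; split => //; exists t.
Qed.

Lemma subgraph_realization_coord S p v :
  subgraph_realization S p -> v \notin S -> p 0 v = 0.
Proof.
move=> [u [w [uS wS _ [t _ <-]]]] vS; rewrite edge_point_coord.
have [vu vw] : v != u /\ v != w.
  by split; apply: contraNneq vS => ->.
by rewrite (negPf vu) (negPf vw) !mulr0 addr0.
Qed.

Hypothesis tree_e : tree_graph e.

Let e_sym : symmetric e. Proof. by case: tree_e. Qed.

Lemma subgraph_realizationU1 S u v : u \in S -> v \notin S -> e u v ->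
  (forall w, w \in S -> e w v -> w = u) ->
  subgraph_realization (v |: S) = subgraph_realization S `|` edge_segment u v.
Proof.
move=> uS vS uv uniq_u; apply/seteqP; split => p.
  move=> [a [b [/setU1P[->|aS] /setU1P[->|bS] ab pab]]].
  - right; case: pab => t _ <-; exists 1.
      by rewrite /= in_itv /= lexx ler01.
    by rewrite /edge_point subrr scale0r add0r -scalerDl subrK.
  - right; rewrite edge_segmentC -(uniq_u b) //; move: ab.
    by case: eqP bS vS => [<- -> //|_ _ _ /=]; rewrite e_sym.
  - right; rewrite -(uniq_u a) //; move: ab.
    by case: eqP aS vS => [-> -> //|].
  - by left; exists a, b.
move=> [[a [b [aS bS ab pab]]]|puv]; [exists a, b|exists u, v].
  by split; rewrite // ?in_setU1 ?aS ?bS orbT.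
by split; rewrite // ?in_setU1 ?eqxx ?uS ?uv ?orbT.
Qed.

Definition connected_in S := forall u v, u \in S -> v \in S ->
  exists2 p, path e u p & last u p = v /\ {subset p <= S}.

(** A simple path from [u] to [w] inside [S], closed up through [v], is a cycle; acyclicity forces
    the path to be trivial. *)
Lemma tree_attach S u w v : connected_in S -> u \in S -> w \in S ->
  v \notin S -> e u v -> e w v -> w = u.
Proof.
move=> cS uS wS vS uv wv; have [p pp [lp pS]] := cS _ _ uS wS.
have [_ _ _ _ acyc] := tree_e.
move: lp; case/shortenP: pp => p' pp' up' sub lp.
have : ucycle e (v :: u :: p').
  rewrite /ucycle /= rcons_path pp' lp wv e_sym uv /=; move: up' => /= ->.
  rewrite andbT inE negb_or; apply/andP; split.
    by apply: contraNneq vS => ->.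
  by apply: contra vS => /sub/pS.
by move=> /acyc /=; case: p' lp {pp' up' sub} => //= ->.
Qed.

(** The tree is grown from one vertex. While vertices remain, connectedness provides an edge leaving
    [S]; by [tree_attach] it is the only edge to its new endpoint, so it is attached at a single
    point. *)
Lemma connected_meets_tree : connected_meets (graph_realization R e).
Proof.
have [n0 _ _ conn _] := tree_e.
rewrite graph_realizationE.
suff H k : (0 < k <= n)%N -> exists S, [/\ #|S| = k, connected_in S,
    closed (subgraph_realization S) & connected_meets (subgraph_realization S)].
  have [|S [Sn _ _]] := H n; first by rewrite n0 leqnn.
  suff -> : S = [set: 'I_n]%SET by [].
  by apply/eqP; rewrite eqEcard finset.subsetT cardsT card_ord Sn leqnn.
elim: k => // k IH /=; case: k IH => [_ _|k IH kn].
  pose o : 'I_n := Ordinal n0.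
  have oE : subgraph_realization [set o] = [set delta_mx 0 o].
    apply/seteqP; split => [_ [u [v [/set1P -> /set1P -> _ [t _ <-]]]]|_ ->].
      by rewrite /= /edge_point -scalerDl subrK scale1r.
    exists o, o; split; rewrite ?inE ?eqxx //; exists 0.
      by rewrite /= in_itv /= lexx ler01.
    by rewrite /edge_point subr0 scale1r scale0r addr0.
  exists [set o]%SET; rewrite cards1 oE; split => //.
  - by move=> u v /set1P -> /set1P ->; exists [::].
  - exact/accessible_closed_set1/hausdorff_accessible/norm_hausdorff.
  - exact: connected_meets1.
have [S [Sk cS clS mS]] := IH (ltnW kn).
have [u [v [uS vS uv]]] : exists u v, [/\ u \in S, v \notin S & e u v].
  have /card_gt0P[u uS] : (0 < #|S|)%N by rewrite Sk.
  apply: contrapT => nuv; suff ST : S = [set: 'I_n]%SET.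
    by move: kn; rewrite -Sk ST cardsT card_ord ltnn.
  apply/setP => v; rewrite inE; rewrite -(closed_connect _ (conn u v)) //.
  apply: intro_closed => [a b|a b ab aS]; first by rewrite !conn.
  by apply: contraT => bS; exfalso; apply: nuv; exists a, b.
have uniq_u w : w \in S -> e w v -> w = u.
  by move=> wS wv; apply: (tree_attach cS uS wS vS).
exists (v |: S); rewrite cardsU1 vS Sk (subgraph_realizationU1 uS vS uv uniq_u).
have neq_uv : u != v by apply: contraNneq vS => <-.
split => //.
- have toS a : a \in S -> exists2 p, path e a p &
      last a p = v /\ {subset p <= v |: S}.
    move=> aS; have [p pp [lp pS]] := cS _ _ aS uS.
    exists (rcons p v); first by rewrite rcons_path pp lp.
    split; first by rewrite last_rcons.
    move=> z; rewrite mem_rcons inE in_setU1.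
    by move=> /orP[->//|/pS ->]; rewrite orbT.
  have fromS b : b \in S -> exists2 p, path e v p &
      last v p = b /\ {subset p <= v |: S}.
    move=> bS; have [p pp [lp pS]] := cS _ _ uS bS.
    exists (u :: p); first by rewrite /= e_sym uv.
    split => // z; rewrite inE in_setU1 => /orP[/eqP ->|/pS ->].
      by rewrite uS orbT.
    by rewrite orbT.
  move=> a b /setU1P[->|aS] /setU1P[->|bS];
    [by exists [::]|exact: fromS|exact: toS|].
  have [p pp [lp pS]] := cS _ _ aS bS; exists p => //; split => // z /pS zS.
  by rewrite in_setU1 zS orbT.
- by apply: closedU => //; exact: edge_segment_closed.
refine (@connected_meets_wedge _ _ _ (delta_mx 0 u : 'rV[R]_n) clS
  (@edge_segment_closed u v) _ mS _); last exact: connected_meets_edge_segment.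
(* The coordinate at [v] vanishes on the old part and equals [t] on the new edge, so they meet only
   where [t] is 0, at the vertex [u]. *)
apply/seteqP; split=> [p [pS [t _ pt]]|_ ->] /=.
    have := subgraph_realization_coord pS vS.
    rewrite -pt edge_point_coord eqxx eq_sym (negPf neq_uv) mulr0 add0r mulr1.
    by move=> ->; rewrite /edge_point subr0 scale1r scale0r addr0.
  split; [exists u, u; rewrite eqxx; split => // |]; exists 0;
    rewrite ?[(_ `[_, _]%classic) _]/= ?in_itv /= ?lexx ?ler01 //;
    by rewrite /edge_point subr0 scale1r scale0r addr0.
Qed.

End TreeRealization.

(** * Maps of tree-like continua to trees *)

Section TreeLike.
Local Open Scope ring_scope.
Variables (R : realType) (X : metricType R).

(** If the ball of radius [r] at [p] misses [Q], any [d] below [r / 2] works on the ball of half the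
    radius. Taking [d] near 0 on the right lets compactness choose one [d] for all of [P]. *)
Lemma compact_closed_gap (P Q : set X) : compact P -> closed Q ->
  P `&` Q = set0 ->
  exists2 d : R, 0 < d & forall p q, P p -> Q q -> d <= mdist p q.
Proof.
move=> /compact_near_coveringP cP clQ PQ0.
have := cP R (0 : R)^'+ (fun d p => forall q, Q q -> d <= mdist p q).
have H p : P p -> \forall p' \near p & d \near (0 : R)^'+,
    forall q, Q q -> d <= mdist p' q.
  move=> Pp; have : nbhs p (~` Q).
    apply: open_nbhs_nbhs; split; first exact: closed_openC.
    by move=> Qp; rewrite -[False]/(set0 p) -PQ0.
  move=> /nbhs_ballP[r /= r0 rQ].
  exists (ball p (r / 2), [set d | d < r / 2]) => /=.
    split; first by apply: nbhsx_ballx; rewrite divr_gt0.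
    by apply: nbhs_right_lt; rewrite divr_gt0.
  move=> [p' d] /= [pp' dr] q Qq; rewrite leNgt; apply/negP => p'q.
  apply: (rQ q) => //; rewrite [r]splitr; apply: (ball_triangle pp').
  by rewrite ballEmdist /=; exact: lt_trans dr.
move=> /(_ _ H) PF.
have [d [/= d0 Hd]] := filter_ex (filterI (nbhs_right_gt (0 : R)) PF).
by exists d => // p q Pp; exact: Hd.
Qed.

Lemma tree_like_map (eps : R) : tree_like X -> 0 < eps ->
  exists n (F : X -> 'rV[R]_n) (Z : set 'rV[R]_n),
  [/\ continuous F, range F `<=` Z, connected_meets Z &
     forall x y, F x = F y -> mdist x y < eps].
Proof.
move=> tX /tX[T [[n [e [tree_e [h [k [hK kK ch ck]]]]]] [f cf df]]].
exists n, (fun x => set_val (h (f x))), (graph_realization R e); split.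
- move=> x; apply: (@continuous_comp _ _ _ (h \o f)).
    by apply: continuous_comp; [exact: cf|exact: ch].
  exact: initial_continuous.
- by move=> _ [x _ <-]; exact: set_valP.
- exact: connected_meets_tree.
move=> x y /val_inj /(can_inj hK) fxy; rewrite -lte_fin.
apply: le_lt_trans (df (f x)); apply: ereal_sup_ubound.
by exists (x, y) => //; split; rewrite /= ?fxy.
Qed.

(** A separation of the intersection of [A] and [B] into [P] and [Q] is carried over by a map [F]
    with small fibers: it would separate the intersection of the images of [A] and [B], which is
    connected in a tree. *)
Lemma tree_like_hereditarily_unicoherent : compact [set: X] -> tree_like X ->
  hereditarily_unicoherent X.
Proof.
move=> cX tX A B cA cB; have hX : hausdorff_space X := @metric_hausdorff _ X.
have [clA clB] := (continuum_closed hX cA, continuum_closed hX cB).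
have clAB := closedI clA clB.
apply/(closed_connectedP clAB) => P Q clP clQ ABPQ PQ0 [p0 Pp0] q0 ABq0.
apply: contrapT => nPq0.
have Qq0 : Q q0 by move: ABq0; rewrite ABPQ => -[].
have cptS (C : set X) : closed C -> compact C := @compact_closed_sub X cX C.
have [d d0 PQd] := compact_closed_gap (cptS _ clP) clQ PQ0.
(* Thickening by a third of the gap keeps points near [P] more than [d / 3] from points near [Q], so
   [F] cannot identify them. *)
have r0 : 0 < d / 3 by rewrite divr_gt0.
pose thick (C : set X) := \bigcup_(p in C) (ball p (d / 3))°.
have oth C : open (thick C) by apply: bigcup_open => p _; exact: open_interior.
have Cth C : C `<=` thick C by move=> p Cp; exists p => //; exact: nbhsx_ballx.
have far x y : thick P x -> thick Q y -> d / 3 < mdist x y.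
  move=> [p Pp /interior_subset px] [q Qq /interior_subset qy].
  have := PQd _ _ Pp Qq; rewrite !ballEmdist /= in px qy.
  have := metric_triangle p x q; have := metric_triangle x y q.
  by rewrite (metric_sym y q); lra.
pose A' := A `\` (thick P `|` thick Q).
have clA' : closed A'.
  by apply: closedI => //; apply: open_closedC; exact: openU.
have A'B : A' `&` B = set0.
  rewrite -subset0 => x [[Ax nx] Bx]; apply: nx.
  have : (A `&` B) x by [].
  by rewrite ABPQ => -[/Cth|/Cth]; [left|right].
have [d' d'0 A'Bd] := compact_closed_gap (cptS _ clA') clB A'B.
have e0 : 0 < Num.min (d / 3) d' by rewrite lt_min r0 d'0.
have [n [F [Z [cF FZ mZ Fe]]]] := tree_like_map tX e0.
have hV : hausdorff_space 'rV[R]_n by exact: norm_hausdorff.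
have clF (C : set X) : closed C -> closed (F @` C).
  move=> clC; apply: compact_closed => //; apply: continuous_compact.
    exact: continuous_subspaceT.
  exact: cptS.
have conF (C : set X) : continuum C -> connected (F @` C).
  move=> [_ _ nC]; apply: connected_continuous_connected => //.
  exact: continuous_subspaceT.
have FZs (C : set X) : F @` C `<=` Z by move=> _ [x _ <-]; apply: FZ; exists x.
have nFAB := mZ _ _ (clF _ clA) (clF _ clB) (FZs A) (FZs B)
  (conF _ cA) (conF _ cB).
have clFB : closed (F @^-1` (F @` B)) by apply: closed_comp => //; exact: clF.
(* [D Q] is the part near [P], and [D P] the part near [Q]: removing the open thickening of the
   opposite piece makes both closed. *)
pose D C := (A `&` F @^-1` (F @` B)) `\` thick C.
have clD C : closed (D C).
  by apply: closedI; [exact: closedI|exact: open_closedC].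
(* Such an [x] shares its image with a point of [B], hence is closer than [d'] to [B] and cannot lie
   in [A']. *)
have thickA x : A x -> (F @` B) (F x) -> thick P x \/ thick Q x.
  move=> Ax [b Bb Fbx]; apply: contrapT => nx.
  have /(A'Bd _ _)/(_ Bb) : A' x by [].
  by rewrite leNgt (lt_le_trans (Fe _ _ (esym Fbx))) // ge_min lexx orbT.
have DQ x : D Q x -> thick P x by move=> [[Ax FBx] nQx]; case: (thickA x).
have DP x : D P x -> thick Q x by move=> [[Ax FBx] nPx]; case: (thickA x).
have disj x y : thick P x -> thick Q y -> F x <> F y.
  move=> Px Qy /Fe; rewrite lt_min => /andP[+ _].
  by rewrite ltNge (ltW (far _ _ Px Qy)).
have PD p : P p -> D Q p.
  move=> Pp; have [Ap Bp] : (A `&` B) p by rewrite ABPQ; left.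
  split; first by split => //; exists p.
  by move=> Qp; exact: (disj p p (Cth _ _ Pp) Qp).
have QD q : Q q -> D P q.
  move=> Qq; have [Aq Bq] : (A `&` B) q by rewrite ABPQ; right.
  split; first by split => //; exists q.
  by move=> Pq; exact: (disj q q Pq (Cth _ _ Qq)).
have : F @` A `&` F @` B `<=` F @` D Q.
  apply: (connected_sub_closed nFAB (clF _ (clD Q)) (clF _ (clD P))).
  - move=> _ [[x Ax <-] FBx]; have [Px|Qx] := thickA x Ax FBx.
      left; exists x => //; split => // Qx; exact: (disj x x).
    right; exists x => //; split => // Px; exact: (disj x x).
  - rewrite -subset0 => _ [[_ [x /DQ Px <-]] [y /DP Qy /esym]].
    exact: disj.
  - have [Ap Bp] : (A `&` B) p0 by rewrite ABPQ; left.
    exists (F p0); split; last by exists p0 => //; exact: PD.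
    by split; exists p0.
move=> /(_ (F q0))[].
  by case: ABq0 => Aq Bq; split; exists q0.
by move=> x /DQ Px /disj; apply => //; exact: Cth.
Qed.

End TreeLike.

(** * Metrizability of the quotient *)

(** If [S K] failed, the sets [A] for which [S] holds of [K] minus [A] would form a proper filter,
    and the local assumption fails at its cluster point in [K]. *)
Lemma compact_induction (T : topologicalType) (K : set T) (S : set T -> Prop) :
  compact K -> S set0 -> (forall A B, A `<=` B -> S B -> S A) ->
  (forall A B, S A -> S B -> S (A `|` B)) ->
  (forall x, K x -> exists2 U, nbhs x U & S U) -> S K.
Proof.
move=> cK S0 Ssub SU Sloc; apply: contrapT => nSK.
pose F : set_system T := [set A | S (K `\` A)].
have FF : ProperFilter F.
  split; first by rewrite /F /= setD0.
  split; first by rewrite /F /= setDT.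
  - by move=> A B FA FB; rewrite /F /= setDIr; exact: SU.
  - by move=> A B AB; apply: Ssub; exact: setDS.
have [|x [Kx clx]] := cK F FF; first by rewrite /F /= setDv.
have [U Ux SUU] := Sloc _ Kx.
have [|y []//] := clx (~` U) U _ Ux.
by apply: Ssub SUU => y [_ /contrapT].
Qed.

Section Metrization.
Local Open Scope ring_scope.
Variables (R : realType) (Y : topologicalType).

(* Continuity is only asked of [rho s] at [s]: it follows elsewhere from the
   triangle inequality. *)
Definition pseudometric_le1 (rho : Y -> Y -> R) := [/\ forall s, rho s s = 0,
  forall s t, rho s t = rho t s, forall u s t, rho s t <= rho s u + rho u t,
  forall s t, 0 <= rho s t <= 1 &
  forall s e, 0 < e -> \forall t \near s, rho s t < e].

Section SupPseudometric.
Variable rho_ : nat -> Y -> Y -> R.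
Hypothesis rhoP : forall n, pseudometric_le1 (rho_ n).

Let w n s t := n.+1%:R^-1 * rho_ n s t.

Definition sup_pseudometric_le1 s t := sup (range (fun n => w n s t)).

Let w_ge0 n s t : 0 <= w n s t.
Proof.
by have [_ _ _ /(_ s t)/andP[? _] _] := rhoP n; rewrite mulr_ge0 // invr_ge0.
Qed.

Let w_le n s t : w n s t <= n.+1%:R^-1.
Proof.
have [_ _ _ /(_ s t)/andP[? ?] _] := rhoP n.
by rewrite -[leRHS]mulr1 ler_wpM2l // invr_ge0.
Qed.

Let sup_le s t c : (forall n, w n s t <= c) -> sup_pseudometric_le1 s t <= c.
Proof.
by move=> H; apply: ge_sup; [exists (w 0 s t), 0%N|move=> _ [n _ <-]].
Qed.

Let w_sup n s t : w n s t <= sup_pseudometric_le1 s t.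
Proof.
apply: ub_le_sup; last by exists n.
exists 1 => _ [m _ <-]; apply: le_trans (w_le _ _ _) _.
by rewrite invf_le1 ?ler1n.
Qed.

Lemma sup_pseudometric_gt0 n s t :
  0 < rho_ n s t -> 0 < sup_pseudometric_le1 s t.
Proof.
by move=> rho0; apply: lt_le_trans (w_sup n s t); rewrite mulr_gt0 // invr_gt0.
Qed.

(** Continuity uses the weights: terms of index at least [N] are below [e / 2] everywhere, and the
    finitely many others are small near [s]. *)
Lemma sup_pseudometricP : pseudometric_le1 sup_pseudometric_le1.
Proof.
split.
- move=> s; apply/eqP; rewrite eq_le (le_trans (w_ge0 0 s s) (w_sup _ _ _)).
  rewrite andbT; apply: sup_le => n.
  by have [rho0 _ _ _ _] := rhoP n; rewrite /w rho0 mulr0.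
- move=> s t; congr sup; apply/seteqP; split => _ [n _ <-]; exists n => //;
    by have [_ sym _ _ _] := rhoP n; rewrite /w sym.
- move=> u s t; apply: sup_le => n.
  apply: le_trans (lerD (w_sup n _ _) (w_sup n _ _)).
  have [_ _ tri _ _] := rhoP n.
  by rewrite /w -mulrDr ler_wpM2l // invr_ge0.
- move=> s t; rewrite (le_trans (w_ge0 0 s t) (w_sup _ _ _)) /=.
  apply: sup_le => n; apply: le_trans (w_le _ _ _) _.
  by rewrite invf_le1 ?ler1n.
- move=> s e e0; have e20 : 0 < e / 2 by rewrite divr_gt0.
  have [N] := ltr_add_invr e20; rewrite add0r => Ne.
  have : \forall t \near s, forall n, (n < N)%N -> rho_ n s t < e / 2.
    elim: (N) => [|m IH]; first by apply: nearW.
    have [_ _ _ _ /(_ s _ e20)] := rhoP m; apply: filterS2 IH => t Hm Ht n.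
    by rewrite ltnS leq_eqVlt => /orP[/eqP ->|/Hm].
  apply: filterS => t Ht; apply: (@le_lt_trans _ _ (e / 2)); last first.
    by rewrite ltr_pdivrMr // ltr_pMr // ltr1n.
  apply: sup_le => n; have [nN|Nn] := ltnP n N; last first.
    apply: le_trans (w_le _ _ _) _; apply: le_trans (ltW Ne).
    by rewrite lef_pV2 ?posrE // ler_nat ltnS.
  have [_ _ _ /(_ s t)/andP[r0 _] _] := rhoP n.
  by apply: le_trans (ltW (Ht _ nN)); rewrite ler_piMl // invf_le1 ?ler1n.
Qed.

End SupPseudometric.

Section MetricType.
Variable rho : Y -> Y -> R.
Hypothesis rhoP : pseudometric_le1 rho.
Hypothesis rho_gt0 : forall s t, s <> t -> 0 < rho s t.

(** This alias of [Y] receives the topology of [rho]. Naming [rhoP] and [rho_gt0] in the body makes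
    it carry the proofs on which its metric instance depends. *)
Definition metrized : Type := let _ := rhoP in let _ := rho_gt0 in Y.

Let rhoxx s : rho s s = 0. Proof. by case: rhoP. Qed.

Let rho_eq0 s t : rho s t = 0 -> s = t.
Proof. by apply: contraPP => /rho_gt0 /lt0r_neq0 /eqP. Qed.

Let rho_sym s t : rho s t = rho t s. Proof. by case: rhoP. Qed.

Let rho_triangle u s t : rho s t <= rho s u + rho u t.
Proof. by case: rhoP. Qed.

HB.instance Definition _ := Choice.copy metrized Y.
HB.instance Definition _ :=
  isMetric.Build R metrized rhoxx rho_eq0 rho_sym rho_triangle.

(** The identity from the compact space [Y] to the Hausdorff space [metrized] is continuous, hence
    closed, hence a homeomorphism. *)
Lemma pseudometric_metrizable : compact [set: Y] -> metrizable R Y.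
Proof.
move=> cY; exists metrized, id, id.
have cid : continuous (id : Y -> metrized).
  move=> s A /nbhs_ballP[e /= e0 eA]; have [_ _ _ _ /(_ s _ e0)] := rhoP.
  by apply: filterS => t st; apply: eA; rewrite ballEmdist.
split => //; apply/continuousP => A oA.
rewrite -[X in open X]setCK; apply: closed_openC; rewrite preimage_id.
have -> : ~` (A : set metrized) = (id : Y -> metrized) @` ~` A.
  by rewrite image_id.
apply: compact_closed; first exact: metric_hausdorff.
apply: continuous_compact; first exact: continuous_subspaceT.
by apply: compact_closed_sub => //; exact: open_closedC.
Qed.

End MetricType.

(** A Urysohn function gives a pseudometric positive near a given pair. Compactness yields one
    positive on each [E n], and the weighted supremum over [n] separates all points of [Y]. *)
Lemma metrizable_sigma_compact_off_diagonal (T : topologicalType) (q : T -> Y)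
  (E : nat -> set (T * T)) :
  continuous q -> (forall p, exists x, q x = p) ->
  compact [set: Y] -> hausdorff_space Y ->
  (forall n, compact (E n)) -> (forall n p, E n p -> q p.1 <> q p.2) ->
  (forall x y, q x <> q y -> exists n, E n (x, y)) -> metrizable R Y.
Proof.
move=> cq q_surj cY hY cE Eq qE.
pose S (A : set (T * T)) := exists rho, pseudometric_le1 rho /\
  forall p, A p -> 0 < rho (q p.1) (q p.2).
have SUn (A_ : nat -> set (T * T)) : (forall n, S (A_ n)) -> S (\bigcup_n A_ n).
  move=> /choice[rho_ Hrho]; exists (sup_pseudometric_le1 rho_); split.
    by apply: sup_pseudometricP => n; case: (Hrho n).
  move=> p [n _ Ap]; have [_ /(_ _ Ap)] := Hrho n.
  by apply: sup_pseudometric_gt0 => m; case: (Hrho m).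
have S0 : S set0.
  exists (fun _ _ => 0); split; last by [].
  split; [by []|by []|by move=> *; rewrite addr0|by rewrite lexx ler01|].
  by move=> s e e0; exact: nearW.
have SE n : S (E n).
  apply: (compact_induction (cE n)) => //.
  - move=> A B AB [rho [rhoP rho0]]; exists rho.
    by split => // p /AB; exact: rho0.
  (* The binary union is the countable union of the sequence [A], [B], [B], and so on. *)
  - move=> A B SA SB; have := SUn (fun n => if n is 0 then A else B).
    have -> : \bigcup_n (if n is 0 then A else B) = A `|` B.
      apply/seteqP; split => [p [[|m] _]|p [Ap|Bp]]; [by left|by right| |].
        by exists 0%N.
      by exists 1%N.
    by apply; case.
  move=> [x y] /Eq /= qxy.
  have /(@uniform_separatorP _ R) [f [cf f01 fx fy]] :
      uniform_separator [set q x] [set q y].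
    have cl1 (s : Y) : closed [set s].
      exact/accessible_closed_set1/hausdorff_accessible.
    apply/(iffLR (@normal_separatorP R _) (compact_normal hY cY)) => //.
    by rewrite -subset0 => z [/= -> ].
  have fqx : f (q x) = 0 by apply: fx; exists (q x).
  have fqy : f (q y) = 1 by apply: fy; exists (q y).
  have f01' s : 0 <= f s <= 1.
    by have := f01 (f s) (ex_intro2 _ _ s I erefl); rewrite /= in_itv.
  exists [set p | f (q p.1) < f (q p.2)].
    exists (q @^-1` (f @^-1` [set r | r < 1 / 2]),
            q @^-1` (f @^-1` [set r | 1 / 2 < r])) => /=.
      split; apply: cq; apply: cf; rewrite ?fqx ?fqy.
        by apply: open_nbhs_nbhs; split; [exact: open_lt|rewrite /=; lra].
      by apply: open_nbhs_nbhs; split; [exact: open_gt|rewrite /=; lra].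
    by move=> [x' y'] /= [h1 h2]; exact: lt_trans h2.
  exists (fun s t => `|f s - f t|); split; first split.
  - by move=> s; rewrite subrr normr0.
  - by move=> s t; rewrite distrC.
  - by move=> u s t; exact: ler_distD.
  - move=> s t; rewrite normr_ge0 /=; have := f01' s; have := f01' t.
    by rewrite ler_norml; lra.
  - by move=> s e e0; have /cvgrPdist_lt/(_ e e0) := cf s.
  - by move=> [x' y'] /= fxy; rewrite normr_gt0 subr_eq0 lt_eqF.
have [rho [rhoP rho0]] := SUn E SE.
apply: (pseudometric_metrizable (rho := rho)) => // s t.
have [[x <-] [y <-]] := (q_surj s, q_surj t) => qxy.
by have [n En] := qE _ _ qxy; apply: (rho0 (x, y)); exists n.
Qed.

(** The sets [W n] are shrinking open neighborhoods of the pairs identified by [q]. As [Y] is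
    Hausdorff, their compact complements exhaust the remaining pairs. *)
Lemma metric_image_metrizable (X : metricType R) (q : X -> Y) :
  compact [set: X] -> hausdorff_space Y -> continuous q ->
  (forall p, exists x, q x = p) -> metrizable R Y.
Proof.
move=> cX hY cq q_surj.
have cY : compact [set: Y].
  have -> : [set: Y] = q @` [set: X].
    by apply/seteqP; split => // p _; have [x <-] := q_surj p; exists x.
  by apply: continuous_compact => //; exact: continuous_subspaceT.
pose W n := \bigcup_(p in [set p | q p.1 = q p.2])
  ((ball p.1 n.+1%:R^-1)° `*` (ball p.2 n.+1%:R^-1)°).
apply: (@metrizable_sigma_compact_off_diagonal _ q (fun n => ~` W n)) => //.
- move=> n; apply: (@subclosed_compact _ _ [set: X * X]) => //.
    apply: open_closedC; apply: bigcup_open => p _.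
    rewrite openE => -[x y] [/= px py].
    by exists ((ball p.1 n.+1%:R^-1)°, (ball p.2 n.+1%:R^-1)°) => //;
      split; exact: nbhs_interior.
  by rewrite -setXTT; exact: compact_setX.
- move=> n [x y] /= nW qxy; apply: nW; exists (x, y) => //.
  by split; apply: nbhsx_ballx; rewrite invr_gt0.
move=> x y qxy; have := hY; rewrite open_hausdorff => /(_ (q x) (q y)).
case; first exact/eqP.
move=> [U V]/= [/set_mem Ux /set_mem Vy] [oU oV /eqP UV0].
have /nbhs_ballP[e1 /= e10 xU] : nbhs x (q @^-1` U).
  by apply: cq; exact: open_nbhs_nbhs.
have /nbhs_ballP[e2 /= e20 yV] : nbhs y (q @^-1` V).
  by apply: cq; exact: open_nbhs_nbhs.
have : 0 < Num.min e1 e2 by rewrite lt_min e10 e20.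
move=> /ltr_add_invr[n]; rewrite add0r lt_min => /andP[n1 n2].
exists n => -[[u v] /= quv [/interior_subset xu /interior_subset yv]].
rewrite -[False]/(set0 (q u)) -UV0; split.
  by apply: xU; apply: le_ball (ltW n1) _ _; exact: ball_sym.
by rewrite quv; apply: yV; apply: le_ball (ltW n2) _ _; exact: ball_sym.
Qed.

End Metrization.

Theorem corollary13 (R : realType) (X : metricType R)
  (X_continuum : continuum [set: X])
  (X_tree_like : tree_like X)
  (X_indecomposable : forall K : set X,
     indecomposable_continuum K -> nowhere_dense K) :
  [/\ partition (meager_composants X) id [set: X],
      upper_semicontinuous (@meager_composant X),
      forall x : X, connected (meager_composant x)
    & dendrite R (meager_composant_space X)].
Proof.
have [[x0 _] cX nX] := X_continuum.
have hX : hausdorff_space X := @metric_hausdorff _ X.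
have huX := tree_like_hereditarily_unicoherent cX X_tree_like.
have uscX := meager_composant_usc hX cX nX huX X_indecomposable.
pose Y := meager_composant_space X.
pose q : X -> Y := \pi_Y%qT.
have qE x y : q x = q y <-> meager_composant x y.
  rewrite -(meager_composant_eqP hX X_indecomposable).
  by split=> [/eqquotP/asboolP|xy]; last exact/eqquotP/asboolP.
have q_open (U : set Y) : open (q @^-1` U) -> open U by [].
have cq : continuous q by exact: pi_continuous.
have q_surj p : exists x, q x = p by exists (repr p); exact: reprK.
have fiberE x : q @^-1` [set q x] = meager_composant x.
  by apply/seteqP; split => y /= /qE; [move=> ?; exact: meager_composant_sym|].
have fib p : connected (q @^-1` [set p]).
  have [x <-] := q_surj p; rewrite fiberE; exact: connected_meager_composant.
have q_usc (A : set X) : closed A -> closed (q @^-1` (q @` A)).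
  move=> /uscX; set M := \bigcup_(x in A) meager_composant x.
  suff -> : q @^-1` (q @` A) = M by [].
  by apply/seteqP; split => y [x Ax] /qE xy; exists x.
have hY : hausdorff_space Y.
  exact: (quotient_hausdorff hX cX q_open q_surj q_usc).
have preC (K : set Y) : continuum K -> continuum (q @^-1` K).
  exact: (quotient_preimage_continuum hX cX q_open cq q_surj q_usc fib).
split.
- exact: (partition_meager_composants hX X_indecomposable).
- exact: uscX.
- exact: connected_meager_composant.
split.
- exact: (metric_image_metrizable cX hY cq q_surj).
- split; first by exists (q x0).
    exact: (quotient_compact cX cq q_surj).
  exact: (quotient_connected cq q_surj nX).
- apply: (quotient_locally_connected hX cX q_open cq q_surj q_usc); last first.
    exact: (quotient_connected cq q_surj nX).
  (* Any point of the open set common to all nearby joining continua serves: its image lies in every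
     continuum of [Y] joining nearby points, because preimages of continua are continua. *)
  move=> x y qxy; have nxy : ~ meager_composant x y by move=> /qE.
  have [U [oU [u Uu]] HU] :=
    near_continuum_contains hX cX nX huX X_indecomposable nxy.
  exists (q u); apply: filterS HU => -[x' y'] /= HU K cK Kx Ky.
  exact: (HU (q @^-1` K) (preC _ cK) Kx Ky).
(* The preimages of the two arcs are continua, yet they intersect in two disjoint nonempty closed
   fibers. *)
- move=> C /simple_closed_curve_arcs[A [B [a [b [cA cB ab ABab]]]]].
  have := huX _ _ (preC _ cA) (preC _ cB); rewrite -preimage_setI ABab.
  have clp p : closed (q @^-1` [set p]).
    apply: closed_comp => //.
    exact/accessible_closed_set1/hausdorff_accessible.
  have [[x qx] [y qy]] := (q_surj a, q_surj b).
  move=> nab; have : q @^-1` [set a; b] `<=` q @^-1` [set a].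
    apply: (connected_sub_closed nab (clp a) (clp b)) => //.
      by rewrite -subset0 => z [[_ /= ->]].
    by exists x; split; [left|].
  by move=> /(_ y); rewrite /= qy => /(_ (or_intror erefl)) /esym.
Qed.
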